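(* Consider the MHE with horizon size $T$ associated with a given FIE, for the system $x_{t+1}=f(x_t,w_t)$, $y_t=h(x_t)+v_t$, and suppose that for every time $t\ge T+1$ the prior estimate satisfies $|x_{t-T}-\bar x_{t-T}|\le|x_{t-T}-\hat x^{\star}_{t-T}|$. Let the uncertainty in the initial state be bounded as $|x_0-\bar x_0|\le M_0$, and the disturbances be bounded as $|w_t|\le M_w$ and $|v_t|\le M_v$ for all $t\in\mathbb{I}_{\ge0}$. Given a constant $\eta\in(0,1)$, the following two conclusions hold. a) Suppose that the associated FIE is RGAS with functions $\beta_x\in\mathcal{KL}$, $\alpha_w,\alpha_v\in\mathcal{K}$, i.e. $|x_t-\hat x_t^{*}|\le\beta_x(|x_0-\bar x_0|,t)+\alpha_w(\|\boldsymbol w_{0:t-1}\|)+\alpha_v(\|\boldsymbol v_{0:t}\|)$, where $\beta_x(s,t)\le\mu(s)\varphi(t)$ for some $\mu\in\mathcal K$, $\varphi\in\mathcal L$ and all $s\in\mathbb R_{\ge0}$, $t\in\mathbb I_{\ge0}$. If there exists $T_{\bar s,\eta}$ such that $\mu(s)\varphi(T_{\bar s,\eta})\le\eta s$ for all $s\in[0,\bar s]$ with $\bar s:=\beta_x(M_0,0)+\frac{1}{1-\eta}\left(\alpha_w(M_w)+\alpha_v(M_v)\right)$, then the MHE is RGAS for all $T\ge T_{\bar s,\eta}$. In particular, if $\mu$ is Lipschitz continuous at the origin, then $T_{\bar s,\eta}$ exists and can be determined from the inequality $\varphi(T_{\bar s,\eta})\le\frac{\eta s^{*}}{\mu(s^{*})}$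 with $s^{*}:=\arg\min_{s\in[0,\bar s]}\frac{s}{\mu(s)}$. b) Suppose that the associated FIE estimate $\hat x_t^{*}$ converges to the true state, i.e. $|x_t-\hat x_t^{*}|\le\rho'(|x_0-\bar x_0|,t)\le\mu'(|x_0-\bar x_0|)\varphi'(t)$ for some $\rho'\in\mathcal{KL}$, $\mu'\in\mathcal K$, $\varphi'\in\mathcal L$ and all $t\in\mathbb I_{\ge0}$. If there exists $T_{\bar s',\eta}$ such that $\mu'(s)\varphi'(T_{\bar s',\eta})\le\eta s$ for all $s\in[0,\bar s']$ with $\bar s':=\rho'(M_0,0)$, then the MHE estimate $\hat x_t^{\star}$ converges to the true state for all $T\ge T_{\bar s',\eta}$. In particular, if $\mu'$ is Lipschitz continuous at the origin, then $T_{\bar s',\eta}$ exists and can be determined from the inequality $\varphi'(T_{\bar s',\eta})\le\frac{\eta s^{\star}}{\mu'(s^{\star})}$ with $s^{\star}:=\arg\min_{s\in[0,\bar s']}\frac{s}{\mu'(s)}$.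
   Context: Notation. $\mathbb I_{\ge0}$ is the set of nonnegative integers, $\mathbb I_{a:b}$ the integers from $a$ to $b$; for discrete times, $t\ge0$ and $t\in\mathbb I_{\ge0}$ are used interchangeably. $|\cdot|$ is the Euclidean norm. $\boldsymbol x_{a:b}$ denotes the sequence $\{x_a,\dots,x_b\}$, and $\|\boldsymbol x_{a:b}\|:=\max_{a\le i\le b}|x_i|$ if $a\le b$, and $0$ if $a>b$. A function $\alpha:\mathbb R_{\ge0}\to\mathbb R_{\ge0}$ is a $\mathcal K$ function if it is continuous, zero at zero and strictly increasing. $\varphi:\mathbb R_{\ge0}\to\mathbb R_{\ge0}$ is an $\mathcal L$ function if it is continuous, nonincreasing and $\varphi(t)\to0$ as $t\to\infty$. $\beta:\mathbb R_{\ge0}\times\mathbb R_{\ge0}\to\mathbb R_{\ge0}$ is a $\mathcal{KL}$ function if $\beta(\cdot,t)\in\mathcal K$ for each $t\ge0$ and $\beta(s,\cdot)\in\mathcal L$ for each $s\ge0$. A function is Lipschitz continuous over a set $S$ if there is a constant $c$ with $|f(x)-f(y)|\le c|x-y|$ for all $x,y\in S$; Lipschitz continuous at the origin means over some neighbourhood of $0$ in $\mathbb R_{\ge0}$. In the $\arg\min$ expressions, the quotient $s/\mu(s)$ (resp. $s/\mu'(s)$) at $s=0$ is understood as its lower limit as $s\to0^+$. System. $x_{t+1}=f(x_t,w_t)$, $y_t=h(x_t)+v_t$, with state $x_t\in\mathbb R^n$, measurement $y_t\in\mathbb R^p$, process disturbance $w_t\in\mathbb R^g$, measurement disturbance $v_t\in\mathbb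 R^p$; $f,h$ are continuous and known; $x_0,w_t,v_t$ are unknown but bounded. FIE (full information estimation). Given cost functions $V_t$ and a prior estimate $\bar x_0$ of $x_0$, the FIE at time $t\in\mathbb I_{\ge0}$ minimizes $V_t(\chi_0-\bar x_0,\boldsymbol\omega_{0:t-1},\boldsymbol\nu_{0:t})$ over $(\chi_0,\boldsymbol\omega_{0:t-1},\boldsymbol\nu_{0:t})$ subject to $\chi_{\tau+1}=f(\chi_\tau,\omega_\tau)$ for $\tau\in\mathbb I_{0:t-1}$, $y_\tau=h(\chi_\tau)+\nu_\tau$ for $\tau\in\mathbb I_{0:t}$, $\chi_0\in\mathbb B_x^0$, $\boldsymbol\omega_{0:t-1}\in\mathbb B_w^{0:t-1}$, $\boldsymbol\nu_{0:t}\in\mathbb B_v^{0:t}$, where the $\mathbb B$'s are given sets of bounded initial states and bounded disturbance sequences (containing the true ones). $\hat x_t^{*}$ denotes the value of $\chi_t$ in an optimal solution of the FIE instance at time $t$. MHE (moving horizon estimation). Given $T\in\mathbb I_{\ge0}$, the associated MHE at time $t\ge T$ minimizes $V_T(\chi_{t-T}-\bar x_{t-T},\boldsymbol\omega_{t-T:t-1},\boldsymbol\nu_{t-T:t})$ subject to $\chi_{\tau+1}=f(\chi_\tau,\omega_\tau)$ for $\tau\in\mathbb I_{t-T:t-1}$, $y_\tau=h(\chi_\tau)+\nu_\tau$ for $\tau\in\mathbb I_{t-T:t}$, $\chi_{t-T}\in\mathbb B_x^{t-T}$, $\boldsymbol\omega_{t-T:t-1}\in\mathbb B_w^{t-T:t-1}$,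 $\boldsymbol\nu_{t-T:t}\in\mathbb B_v^{t-T:t}$, where $\bar x_{t-T}$ is a prior estimate of $x_{t-T}$. $\hat x_t^{\star}$ denotes the value of $\chi_t$ in an optimal solution of the MHE instance at time $t$. For $t<T$ the MHE estimate coincides with the FIE estimate. An MHE instance at time $t\ge T$ is treated as an instance of the associated FIE confined to the window $[t-T,t]$ (initial time $t-T$, prior $\bar x_{t-T}$), and stability inequalities of the associated FIE are understood to apply to such time-shifted instances. RGAS (robust global asymptotic stability). An estimate $\hat x_t$ of $x_t$ is RGAS if there exist $\beta_x\in\mathcal{KL}$ and $\alpha_w,\alpha_v\in\mathcal K$ such that $|x_t-\hat x_t|\le\beta_x(|x_0-\bar x_0|,t)+\alpha_w(\|\boldsymbol w_{0:t-1}\|)+\alpha_v(\|\boldsymbol v_{0:t}\|)$ for all $x_0$, $\bar x_0$, all $\boldsymbol w_{0:t-1}\in\mathbb B_w^{0:t-1}$, $\boldsymbol v_{0:t}\in\mathbb B_v^{0:t}$ and all $t\in\mathbb I_{\ge0}$. FIE (MHE) is RGAS if its estimate $\hat x_t^{*}$ ($\hat x_t^{\star}$) is.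
   Formalization: The horizon size is required to be positive (T ≥ 1): for T = 0 the condition on the prior compares it with the estimate computed from that same prior, and both conclusions can fail. *)

(* Defs.v *)
(* MathComp-Analysis development over an arbitrary R : realType. *)
From HB Require Import structures.
From mathcomp Require Import all_boot all_order all_algebra.
From mathcomp Require Import all_classical all_reals all_analysis.

Set Implicit Arguments.
Unset Strict Implicit.
Unset Printing Implicit Defensive.

Import Order.TTheory GRing.Theory Num.Theory.
Import numFieldNormedType.Exports.

Local Open Scope classical_set_scope.
Local Open Scope ring_scope.

(* The norm that MathComp-Analysis puts on 'rV[R]_n is the sup norm; it induces
   the same topology (used for continuity) but not the Euclidean length. *)
Definition enorm (R : realType) (n : nat) (x : 'rV[R]_n) : R :=
  Num.sqrt (\sum_(i < n) x ord0 i ^+ 2).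

(* max of |u_i| over the half-open range a <= i < b, and 0 if it is empty;
   thus ||u_{a:b}|| is seqnorm u a b.+1 and ||u_{a:b-1}|| is seqnorm u a b. *)
Definition seqnorm (R : realType) (n : nat) (u : nat -> 'rV[R]_n) (a b : nat) : R :=
  \big[Num.max/0]_(a <= i < b) enorm (u i).

(* Comparison functions: a function on the nonnegative reals is represented by
   a function on R of which only the restriction to [0, +oo[ matters. *)
Definition classK (R : realType) (alpha : R -> R) : Prop :=
  [/\ forall s : R, 0 <= s -> 0 <= alpha s,
      {within `[0, +oo[, continuous alpha},
      alpha 0 = 0 &
      forall s t : R, 0 <= s -> s < t -> alpha s < alpha t].

Definition classL (R : realType) (phi : R -> R) : Prop :=
  [/\ forall t : R, 0 <= t -> 0 <= phi t,
      {within `[0, +oo[, continuous phi},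
      forall s t : R, 0 <= s -> s <= t -> phi t <= phi s &
      phi t @[t --> +oo] --> 0].

Definition classKL (R : realType) (beta : R -> R -> R) : Prop :=
  (forall t : R, 0 <= t -> classK (beta ^~ t)) /\
  (forall s : R, 0 <= s -> classL (beta s)).

Definition lipschitz_at_origin (R : realType) (mu : R -> R) : Prop :=
  exists c d : R, 0 < d /\
    forall s t : R, 0 <= s < d -> 0 <= t < d -> `|mu s - mu t| <= c * `|s - t|.

(* s / mu(s) for s > 0, extended to s = 0 by its lower limit as s -> 0+, which
   may be +oo. *)
Definition quot (R : realType) (mu : R -> R) (s : R) : \bar R :=
  if s == 0 then limf_einf (fun r : R => (r / mu r)%:E) 0^'+
  else (s / mu s)%:E.

Definition is_argmin_quot (R : realType) (mu : R -> R) (sbar sstar : R) : Prop :=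
  0 <= sstar <= sbar /\
  forall s : R, 0 <= s <= sbar -> (quot mu sstar <= quot mu s)%E.

Definition contractive_horizon (R : realType) (mu phi : R -> R) (eta sbar : R)
    (T : nat) : Prop :=
  forall s : R, 0 <= s <= sbar -> mu s * phi T%:R <= eta * s.

(* Data of the estimation problem. A window starts at time k and has N steps, so
   it covers the N process disturbances at times k, ..., k + N - 1 and the N + 1
   measurements at times k, ..., k + N. The costs do not depend on k; the
   constraint sets may. *)
Record estimation_problem (R : realType) (n g p : nat) := EstimationProblem {
  dyn : 'rV[R]_n * 'rV[R]_g -> 'rV[R]_n ;
  obs : 'rV[R]_n -> 'rV[R]_p ;
  cost : forall N : nat,
    'rV[R]_n -> ('I_N -> 'rV[R]_g) -> ('I_N.+1 -> 'rV[R]_p) -> R ;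
  Bx : nat -> set 'rV[R]_n ;
  Bw : forall k N : nat, set ('I_N -> 'rV[R]_g) ;
  Bv : forall k N : nat, set ('I_N.+1 -> 'rV[R]_p) }.

Definition window (V : Type) (u : nat -> V) (k m : nat) : 'I_m -> V :=
  fun i => u (k + i)%N.

Definition is_trajectory (R : realType) (n g p : nat)
    (P : estimation_problem R n g p)
    (x : nat -> 'rV[R]_n) (w : nat -> 'rV[R]_g) : Prop :=
  forall t, x t.+1 = dyn P (x t, w t).

Definition output (R : realType) (n g p : nat) (P : estimation_problem R n g p)
    (x : nat -> 'rV[R]_n) (v : nat -> 'rV[R]_p) : nat -> 'rV[R]_p :=
  fun t => obs P (x t) + v t.

(* The constraint sets of the window contain the true initial state and the true
   disturbance sequences. *)
Definition truth_admissible (R : realType) (n g p : nat)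
    (P : estimation_problem R n g p) (k N : nat)
    (x : nat -> 'rV[R]_n) (w : nat -> 'rV[R]_g) (v : nat -> 'rV[R]_p) : Prop :=
  [/\ Bx P k (x k), Bw P k (window w k (m := N)) &
      Bv P k (window v k (m := N.+1))].

Definition feasible (R : realType) (n g p : nat) (P : estimation_problem R n g p)
    (k N : nat) (y : nat -> 'rV[R]_p) (chi : 'I_N.+1 -> 'rV[R]_n)
    (omega : 'I_N -> 'rV[R]_g) (nu : 'I_N.+1 -> 'rV[R]_p) : Prop :=
  [/\ forall i : 'I_N,
        chi (lift ord0 i) = dyn P (chi (widen_ord (leqnSn N) i), omega i),
      forall i : 'I_N.+1, y (k + i)%N = obs P (chi i) + nu i,
      Bx P k (chi ord0), Bw P k omega & Bv P k nu].

(* z is the final state of some minimizer of the window problem with prior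
   xbar. The full information problem at time t is the window k = 0, N = t. *)
Definition window_estimate (R : realType) (n g p : nat)
    (P : estimation_problem R n g p) (k N : nat) (y : nat -> 'rV[R]_p)
    (xbar z : 'rV[R]_n) : Prop :=
  exists (chi : 'I_N.+1 -> 'rV[R]_n) (omega : 'I_N -> 'rV[R]_g)
         (nu : 'I_N.+1 -> 'rV[R]_p),
    [/\ feasible P k y chi omega nu,
        forall (chi' : 'I_N.+1 -> 'rV[R]_n) (omega' : 'I_N -> 'rV[R]_g)
               (nu' : 'I_N.+1 -> 'rV[R]_p),
          feasible P k y chi' omega' nu' ->
          cost P (chi ord0 - xbar) omega nu <= cost P (chi' ord0 - xbar) omega' nu' &
        z = chi ord_max].

Definition mhe_estimate (R : realType) (n g p : nat)
    (P : estimation_problem R n g p) (T t : nat) (y : nat -> 'rV[R]_p)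
    (xbar : nat -> 'rV[R]_n) (z : 'rV[R]_n) : Prop :=
  if (t < T)%N then window_estimate P 0 t y (xbar 0%N) z
  else window_estimate P (t - T) T y (xbar (t - T)%N) z.

(* One use of an estimator: true signals, an initial time start, a number len of
   elapsed steps, a prior of the state at time start, and the resulting estimate
   of the state at time start + len. *)
Record episode (R : realType) (n g p : nat) := Episode {
  ep_x : nat -> 'rV[R]_n ;
  ep_w : nat -> 'rV[R]_g ;
  ep_v : nat -> 'rV[R]_p ;
  start : nat ;
  len : nat ;
  prior : 'rV[R]_n ;
  est : 'rV[R]_n }.

Definition prior_error (R : realType) (n g p : nat) (e : episode R n g p) : R :=
  enorm (ep_x e (start e) - prior e).

Definition est_error (R : realType) (n g p : nat) (e : episode R n g p) : R :=
  enorm (ep_x e (start e + len e) - est e).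

(* Full information estimation, together with its time-shifted instances
   (start <> 0) confined to windows of the actual trajectory. *)
Definition fie_episodes (R : realType) (n g p : nat)
    (P : estimation_problem R n g p) : set (episode R n g p) :=
  [set e | [/\ is_trajectory P (ep_x e) (ep_w e),
               truth_admissible P (start e) (len e) (ep_x e) (ep_w e) (ep_v e) &
               window_estimate P (start e) (len e) (output P (ep_x e) (ep_v e))
                 (prior e) (est e)]].

(* Moving horizon estimation with horizon T run over the times 0, ..., len, with
   priors that are no worse than the estimates from time T + 1 on. *)
Definition mhe_episodes (R : realType) (n g p : nat)
    (P : estimation_problem R n g p) (T : nat) : set (episode R n g p) :=
  [set e | [/\ start e = 0%N,
               is_trajectory P (ep_x e) (ep_w e),
               forall k N, (k + N <= len e)%N ->
                 truth_admissible P k N (ep_x e) (ep_w e) (ep_v e) &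
               exists xbar xhat : nat -> 'rV[R]_n,
                 [/\ prior e = xbar 0%N,
                     est e = xhat (len e),
                     forall t, (t <= len e)%N ->
                       mhe_estimate P T t (output P (ep_x e) (ep_v e)) xbar (xhat t) &
                     forall t, (T + 1 <= t <= len e)%N ->
                       enorm (ep_x e (t - T)%N - xbar (t - T)%N)
                       <= enorm (ep_x e (t - T)%N - xhat (t - T)%N)]]].

Definition bounded_episodes (R : realType) (n g p : nat) (M0 Mw Mv : R) :
    set (episode R n g p) :=
  [set e | [/\ prior_error e <= M0,
               forall t, enorm (ep_w e t) <= Mw &
               forall t, enorm (ep_v e t) <= Mv]].

Definition RGAS_by (R : realType) (n g p : nat) (E : set (episode R n g p))
    (beta : R -> R -> R) (alphaw alphav : R -> R) : Prop :=
  forall e, E e ->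
    est_error e <= beta (prior_error e) (len e)%:R
                   + alphaw (seqnorm (ep_w e) (start e) (start e + len e))
                   + alphav (seqnorm (ep_v e) (start e) (start e + len e).+1).

Definition RGAS (R : realType) (n g p : nat) (E : set (episode R n g p)) : Prop :=
  exists beta alphaw alphav,
    [/\ classKL beta, classK alphaw, classK alphav & RGAS_by E beta alphaw alphav].

Definition converges_by (R : realType) (n g p : nat) (E : set (episode R n g p))
    (rho : R -> R -> R) (mu phi : R -> R) : Prop :=
  forall e, E e ->
    est_error e <= rho (prior_error e) (len e)%:R
                <= mu (prior_error e) * phi (len e)%:R.

Definition converges (R : realType) (n g p : nat) (E : set (episode R n g p)) : Prop :=
  exists rho mu phi,
    [/\ classKL rho, classK mu, classL phi & converges_by E rho mu phi].

(* Main.v *)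
(* Let e_t be the MHE error, B = beta(|x_0 - xbar_0|, 0), and a the sum of the
   disturbance gains over the whole run. Up to time T the MHE is an FIE, so
   e_t <= B + a. After time T it is an FIE on the last T steps whose prior is no
   worse than the estimate made T steps before, so as long as e_(t-T) <= sbar the
   contraction gives e_t <= eta e_(t-T) + a; and sbar is chosen so that this
   recursion never leaves [0, sbar]. Iterating,
   e_t <= B eta^(t/T - 1) + a / (1 - eta).
   A Lipschitz bound mu(s) <= K s shows that s / mu(s) is bounded away from 0,
   whence the existence of the horizons. *)
Require Import Defs.
From HB Require Import structures.
From mathcomp Require Import all_boot all_order all_algebra.
From mathcomp Require Import all_classical all_reals all_analysis.
From mathcomp Require Import ring lra.

Set Implicit Arguments.
Unset Strict Implicit.
Unset Printing Implicit Defensive.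

Import Order.TTheory GRing.Theory Num.Theory.
Import numFieldNormedType.Exports.

Local Open Scope classical_set_scope.
Local Open Scope ring_scope.

(** * Comparison functions *)

Definition nondecreasing_gain (R : realType) (alpha : R -> R) : Prop :=
  (forall s, 0 <= s -> 0 <= alpha s) /\
  (forall s t, 0 <= s -> s <= t -> alpha s <= alpha t).

Lemma classK_nondecreasing (R : realType) (alpha : R -> R) :
  classK alpha -> nondecreasing_gain alpha.
Proof.
move=> [ge0 _ _ incr]; split=> // s t s0.
by rewrite le_eqVlt => /predU1P[-> // | /(incr _ _ s0)/ltW].
Qed.

Lemma classK_gt0 (R : realType) (mu : R -> R) (s : R) :
  classK mu -> 0 < s -> 0 < mu s.
Proof. by move=> [_ _ mu0 incr] s0; rewrite -mu0; apply: incr. Qed.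

Lemma classK_scale (R : realType) (c : R) (alpha : R -> R) :
  0 < c -> classK alpha -> classK (fun s => c * alpha s).
Proof.
move=> c0 [ge0 cont alpha0 incr]; split.
- by move=> s s0; rewrite mulr_ge0 ?ge0 // ltW.
- by move=> s; apply: cvgM; [exact: cvg_cst | exact: cont].
- by rewrite alpha0 mulr0.
- by move=> s t s0 st; rewrite ltr_pM2l ?incr.
Qed.

Lemma classL_scale (R : realType) (c : R) (phi : R -> R) :
  0 <= c -> classL phi -> classL (fun t => c * phi t).
Proof.
move=> c0 [ge0 cont decr lim]; split.
- by move=> t t0; rewrite mulr_ge0 ?ge0.
- by move=> t; apply: cvgM; [exact: cvg_cst | exact: cont].
- by move=> s t s0 st; rewrite ler_wpM2l ?decr.
- by rewrite -(mulr0 c); apply: cvgM; [exact: cvg_cst | exact: lim].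
Qed.

Lemma classL_eventually_le (R : realType) (phi : R -> R) (eps : R) :
  classL phi -> 0 < eps -> exists N : nat, phi N%:R <= eps.
Proof.
move=> [_ _ _ lim] eps0.
have /cvgrPdist_le/(_ _ eps0)[M [_ HM]] := lim.
exists (Num.truncn M).+1; have := HM _ (truncnS_gt M).
by rewrite sub0r normrN => /(le_trans (ler_norm _)).
Qed.

(** * Geometric decay and the delayed contraction *)

(* [eta ^ (t / T - 1)]: it is at least 1 up to time [T] and loses a factor [eta]
   over each further horizon. *)
Definition decay (R : realType) (eta : R) (T : nat) (t : R) : R :=
  expR (ln eta * (t / T%:R - 1)).

Lemma decay_gt0 (R : realType) (eta : R) (T : nat) (t : R) : 0 < decay eta T t.
Proof. exact: expR_gt0. Qed.

Lemma decay_ge1 (R : realType) (eta : R) (T t : nat) :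
  0 < eta < 1 -> (0 < T)%N -> (t <= T)%N -> 1 <= decay eta T t%:R.
Proof.
move=> eta01 T0 tT; rewrite /decay -[leLHS]expR0 ler_expR mulr_le0 //.
  by rewrite ltW // ln_lt0.
by rewrite subr_le0 ler_pdivrMr ?ltr0n // mul1r ler_nat.
Qed.

Lemma decay_shift (R : realType) (eta : R) (T t : nat) :
  0 < eta -> (0 < T)%N -> (T <= t)%N ->
  decay eta T t%:R = eta * decay eta T (t - T)%:R.
Proof.
move=> eta0 T0 Tt; rewrite /decay -{2}(@lnK _ eta) ?posrE // -expRD natrB //.
by congr expR; field; rewrite pnatr_eq0 -lt0n.
Qed.

Lemma decay_classL (R : realType) (eta : R) (T : nat) :
  0 < eta < 1 -> (0 < T)%N -> classL (decay eta T).
Proof.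
move=> eta01 T0; have ln_lt0 : ln eta < 0 by exact: ln_lt0.
have TR0 : 0 < T%:R :> R by rewrite ltr0n.
split.
- by move=> t _; apply/ltW/decay_gt0.
- apply: continuous_subspaceT => t.
  apply: (@cvg_comp _ _ _ (fun t => ln eta * (t / T%:R - 1)) expR);
    last exact: continuous_expR.
  apply: cvgM; first exact: cvg_cst.
  by apply: cvgB; [apply: cvgM; [exact: cvg_id | exact: cvg_cst] | exact: cvg_cst].
- move=> s t s0 st; rewrite /decay ler_expR; apply: ler_wnM2l; first exact: ltW.
  by rewrite lerD2r ler_pM2r // invr_gt0.
(* As [ln eta < 0], the function is a constant times [expR (- u)] with [u] linear in [t] of positive
   slope, hence tends to 0. *)
- have -> : decay eta T =
      fun t => expR (- ln eta) * expR (- ((- ln eta / T%:R) * t)).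
    by apply/funext => t; rewrite /decay -expRD; congr expR; field; rewrite gt_eqF.
  rewrite -(mulr0 (expR (- ln eta))); apply: cvgM; first exact: cvg_cst.
  apply: (@cvg_comp _ _ _ (fun t => - ln eta / T%:R * t) (fun u => expR (- u)));
    last exact: cvgr_expR.
  by apply: gt0_cvgMry; [rewrite divr_gt0 // oppr_gt0 | exact: cvg_id].
Qed.

Lemma classKL_decay (R : realType) (alpha : R -> R) (eta : R) (T : nat) :
  classK alpha -> 0 < eta < 1 -> (0 < T)%N ->
  classKL (fun s t => alpha s * decay eta T t).
Proof.
move=> Kalpha eta01 T0; split=> [t t0 | s s0].
  have -> : (fun s => alpha s * decay eta T t) = (fun s => decay eta T t * alpha s).
    by apply/funext => s; rewrite mulrC.
  by apply: classK_scale Kalpha; exact: decay_gt0.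
apply: classL_scale (decay_classL eta01 T0).
by case: Kalpha => + _ _ _; apply.
Qed.

(** [A] is the fixed point of [a |-> eta * a + (1 - eta) * A]. Hence a recursion step maps the bound
    [B * D + A] to [B * (eta * D) + A], and multiplying [D] by [eta] is what advancing [decay] by
    one horizon does. *)
Lemma delayed_contraction_bound (R : realType) (eta A B sbar : R) (T L : nat)
    (e : nat -> R) :
  0 < eta < 1 -> (0 < T)%N -> 0 <= A -> 0 <= B -> B + A <= sbar ->
  (forall t, (t <= T)%N -> (t <= L)%N -> e t <= B + (1 - eta) * A) ->
  (forall t, (T < t)%N -> (t <= L)%N -> e (t - T)%N <= sbar ->
     e t <= eta * e (t - T)%N + (1 - eta) * A) ->
  forall t, (t <= L)%N -> e t <= B * decay eta T t%:R + A.
Proof.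
move=> eta01 T0 A0 B0 sbarP short long t tL.
have [eta0 eta1] := andP eta01.
(* Strong induction carries both bounds: the uniform one keeps [e (t - T)] below [sbar], which
   licenses the contraction; the decaying one is the goal. *)
suff: e t <= B + A /\ e t <= B * decay eta T t%:R + A by case.
elim/ltn_ind: t tL => t IH tL.
have [tT | Tt] := leqP t T.
  have : e t <= B + A by have := short t tT tL; nra.
  move=> etB; split=> //; apply: le_trans etB _.
  by rewrite lerD2r ler_peMr // decay_ge1.
have [||etB etD] := IH (t - T)%N; first by rewrite ltn_subrL T0 (leq_trans _ Tt).
  exact: leq_trans (leq_subr _ _) tL.
have := long t Tt tL (le_trans etB sbarP).
rewrite (@decay_shift _ eta T t) ?(ltnW Tt) // => et.
have := decay_gt0 eta T (t - T)%:R; set D := decay _ _ _ in etD * => D0.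
by split; nra.
Qed.

(** * Error bound for the moving horizon estimate *)

Lemma seqnorm_ge0 (R : realType) (n : nat) (u : nat -> 'rV[R]_n) (a b : nat) :
  0 <= seqnorm u a b.
Proof. by apply: bigmax_ge_id. Qed.

Lemma seqnorm_le (R : realType) (n : nat) (u : nat -> 'rV[R]_n) (a b : nat) (M : R) :
  0 <= M -> (forall i, enorm (u i) <= M) -> seqnorm u a b <= M.
Proof. by move=> M0 uM; apply: bigmax_le. Qed.

Lemma seqnorm_sub (R : realType) (n : nat) (u : nat -> 'rV[R]_n) (a b b' : nat) :
  (b <= b')%N -> seqnorm u a b <= seqnorm u 0 b'.
Proof. by move=> bb'; apply: le_bigmax_nat. Qed.

Lemma enorm_ge0 (R : realType) (n : nat) (x : 'rV[R]_n) : 0 <= enorm x.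
Proof. exact: sqrtr_ge0. Qed.

(* The gains need not be strictly increasing, so that disturbance-free bounds are
   covered by zero gains. *)
Lemma mhe_error_bound (R : realType) (n g p : nat) (P : estimation_problem R n g p)
    (M0 Mw Mv eta : R) (beta : R -> R -> R) (aw av : R -> R) (T : nat) :
  0 <= M0 -> 0 <= Mw -> 0 <= Mv -> 0 < eta < 1 -> (0 < T)%N ->
  classKL beta -> nondecreasing_gain aw -> nondecreasing_gain av ->
  RGAS_by (fie_episodes P) beta aw av ->
  (forall e, fie_episodes P e -> len e = T ->
     prior_error e <= beta M0 0 + (1 - eta)^-1 * (aw Mw + av Mv) ->
     est_error e <= eta * prior_error e
                    + aw (seqnorm (ep_w e) (start e) (start e + len e))
                    + av (seqnorm (ep_v e) (start e) (start e + len e).+1)) ->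
  RGAS_by (mhe_episodes P T `&` bounded_episodes M0 Mw Mv)
    (fun s t => beta s 0 * decay eta T t)
    (fun s => (1 - eta)^-1 * aw s) (fun s => (1 - eta)^-1 * av s).
Proof.
move=> M00 Mw0 Mv0 eta01 T0 [betaK betaL] [aw0 awle] [av0 avle] fie contr
  [x w v k L x0 z] [[/= -> traj adm [xbar [xhat [-> -> est prior]]]]].
rewrite /bounded_episodes /prior_error /= => -[dM0 wMw vMv].
rewrite /est_error /prior_error /= !add0n in dM0 *.
set d0 := enorm _ in dM0 *.
have [eta0 eta1] := andP eta01.
have [beta00 beta0le] := classK_nondecreasing (betaK 0 (lexx 0)).
have ge0 := seqnorm_ge0.
have inv0 : 0 < (1 - eta)^-1 by rewrite invr_gt0 subr_gt0.
set W := seqnorm w 0 L; set V := seqnorm v 0 L.+1.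
have W0 : 0 <= W := ge0 _ _ _ _ _.
have V0 : 0 <= V := ge0 _ _ _ _ _.
have awW : aw W <= aw Mw by apply: awle => //; exact: seqnorm_le.
have avV : av V <= av Mv by apply: avle => //; exact: seqnorm_le.
(* The disturbances in any window are charged at their norm over the whole run, so every recursion
   step has the same additive term. *)
have gain a b : (b <= L)%N ->
    aw (seqnorm w a b) + av (seqnorm v a b.+1) <= aw W + av V.
  by move=> bL; apply: lerD; [apply: awle | apply: avle] => //; exact: seqnorm_sub.
have sumK : (1 - eta) * ((1 - eta)^-1 * (aw W + av V)) = aw W + av V.
  by rewrite mulVKf // gt_eqF // subr_gt0.
rewrite -addrA -mulrDr.
(* [A] is [(1 - eta)^-1] times the gains at the actual norms and [B] is [beta d0 0]; the threshold
   is the same expression at the worst case [M0], [Mw], [Mv], so [B + A] stays below it. *)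
apply: (@delayed_contraction_bound _ eta _ _
  (beta M0 0 + (1 - eta)^-1 * (aw Mw + av Mv)) T L
  (fun t => enorm (x t - xhat t))) => //.
- by rewrite mulr_ge0 ?addr_ge0 ?aw0 ?av0 // ltW.
- by apply: beta00; exact: enorm_ge0.
- apply: lerD; first by apply: beta0le => //; exact: enorm_ge0.
  by rewrite ler_pM2l // lerD.
- move=> t tT tL; rewrite sumK.
  have /fie : fie_episodes P (Episode x w v 0 t (xbar 0%N) (xhat t)).
    split=> //=; first exact: adm.
    move: (est t tL); rewrite /mhe_estimate.
    (* At [t = T] the moving window starts at time 0, so it is still the full information
       problem. *)
    by case: ltnP => // Tt; have -> : t = T by [apply/eqP; rewrite eqn_leq tT];
      rewrite subnn.
  rewrite /est_error /prior_error /= add0n -addrA => /le_trans; apply.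
  apply: lerD (gain _ _ tL).
  by have [_ _ + _] := betaL _ (enorm_ge0 (x 0%N - xbar 0%N)); apply.
(* The window is a full information episode started at [t - T]. Its prior error is at most the
   estimation error at [t - T], so it lies below the threshold and the one-horizon contraction
   applies. *)
- move=> t Tt tL eS; rewrite sumK.
  have Tt' : (t - T + T)%N = t by rewrite subnK // ltnW.
  have pr : enorm (x (t - T)%N - xbar (t - T)%N) <= enorm (x (t - T)%N - xhat (t - T)%N).
    by apply: prior; rewrite addn1 Tt.
  have := contr (Episode x w v (t - T) T (xbar (t - T)%N) (xhat t)).
  rewrite /est_error /prior_error /= Tt' => /(_ _ erefl (le_trans pr eS)) H.
  have {H}/H : fie_episodes P (Episode x w v (t - T) T (xbar (t - T)%N) (xhat t)).
    split=> //=; first by apply: adm; rewrite Tt'.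
    by move: (est t tL); rewrite /mhe_estimate ltnNge (ltnW Tt).
  rewrite -addrA => /le_trans; apply; apply: lerD (gain _ _ tL).
  by rewrite ler_pM2l.
Qed.

(** * The quotient [s / mu s] and the choice of the horizon *)

Lemma limf_einf_ge (T : choiceType) (X : filteredType T) (R : realType)
    (f : X -> \bar R) (F : set (set X)) (x : \bar R) :
  F [set r | (x <= f r)%E] -> (x <= limf_einf f F)%E.
Proof.
move=> Fx; rewrite limf_einfE.
apply: (@le_trans _ _ (ereal_inf (f @` [set r | (x <= f r)%E]))).
  by apply: le_ereal_inf_tmp => _ [r /= xr <-].
by apply: ereal_sup_ubound; exists [set r | (x <= f r)%E].
Qed.

Lemma limf_einf_gt (T : choiceType) (X : filteredType T) (R : realType)
    (f : X -> \bar R) (F : set (set X)) (x : \bar R) :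
  Filter F -> (x < limf_einf f F)%E -> F [set r | (x < f r)%E].
Proof.
move=> FF; rewrite limf_einfE => /ereal_sup_gt[_ [V FV <-] xV].
apply: filterS FV => r Vr /=; apply: lt_le_trans xV _.
by apply: ereal_inf_lbound; exists r.
Qed.

Lemma quot0 (R : realType) (mu : R -> R) :
  quot mu 0 = limf_einf (fun r : R => (r / mu r)%:E) 0^'+.
Proof. by rewrite /quot eqxx. Qed.

Lemma quot_pos (R : realType) (mu : R -> R) (s : R) :
  0 < s -> quot mu s = (s / mu s)%:E.
Proof. by move=> s0; rewrite /quot gt_eqF. Qed.

(** Below [d], compare with [mu 0 = 0]. On [[d, sbar]], monotonicity gives
    [mu s <= mu sbar <= (mu sbar / d) * s]. The range [s < d] is kept even beyond [sbar], because
    the value of [quot] at 0 is a limit from the right. *)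
Lemma lipschitz_at_origin_linear_bound (R : realType) (mu : R -> R) (sbar : R) :
  classK mu -> lipschitz_at_origin mu ->
  exists K d, [/\ 0 < K, 0 < d &
    forall s, 0 <= s -> s < d \/ s <= sbar -> mu s <= K * s].
Proof.
move=> Kmu [c [d [d0 lip]]]; have [mu_ge0 mu_le] := classK_nondecreasing Kmu.
have mu0 : mu 0 = 0 by case: Kmu.
(* The 1 makes the slope positive, so that it can be inverted. *)
exists (Num.max 1 (Num.max c (mu sbar / d))), d; split=> //.
  by rewrite lt_max ltr01.
move=> s s0 sP; have [sd | ds] := ltP s d.
  have := lip s 0; rewrite s0 sd lexx d0 mu0 !subr0 !ger0_norm ?mu_ge0 //.
  move=> /(_ erefl erefl)/le_trans; apply.
  by rewrite ler_wpM2r // !le_max lexx orbT.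
case: sP => [|ssbar]; first by rewrite ltNge ds.
apply: (@le_trans _ _ (mu sbar / d * s)).
  by rewrite mulrAC ler_pdivlMr // ler_pM ?mu_ge0 ?mu_le // ltW //.
by rewrite ler_wpM2r // !le_max lexx !orbT.
Qed.

Lemma contractive_horizon_exists (R : realType) (mu phi : R -> R) (eta sbar : R) :
  0 < eta -> classK mu -> classL phi -> lipschitz_at_origin mu ->
  exists Ts : nat, contractive_horizon mu phi eta sbar Ts.
Proof.
move=> eta0 Kmu Lphi lip.
have [K [d [K0 d0 muK]]] := lipschitz_at_origin_linear_bound sbar Kmu lip.
(* With [phi Ts <= eta / K], the linear bound gives [mu s * phi Ts <= K * s * (eta / K)]. *)
have [Ts phiTs] := classL_eventually_le Lphi (divr_gt0 eta0 K0).
exists Ts => s /andP[s0 ssbar].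
have phi0 : 0 <= phi Ts%:R by case: Lphi => + _ _ _; apply.
apply: (@le_trans _ _ (K * s * phi Ts%:R)).
  by rewrite ler_wpM2r // muK //; right.
rewrite mulrAC ler_wpM2r //.
by move: phiTs; rewrite ler_pdivlMr // mulrC.
Qed.

(* [quot mu] is lower semicontinuous at 0: if 0 is not a minimizer, then neither
   is any point near 0, and the extreme value theorem applies away from 0. *)
Lemma is_argmin_quot_exists (R : realType) (mu : R -> R) (sbar : R) :
  classK mu -> 0 <= sbar -> exists sstar, is_argmin_quot mu sbar sstar.
Proof.
move=> Kmu sbar0.
have [[s [/andP[s0 ssbar] sq]] | no] := pselect
    (exists s, 0 < s <= sbar /\ (quot mu s < quot mu 0)%E); last first.
  exists 0; split=> [|s /andP[+ ssbar]]; first by rewrite lexx.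
  rewrite le_eqVlt => /predU1P[<- // | s0]; rewrite leNgt.
  by apply/negP => sq; apply: no; exists s; rewrite s0.
have : \forall r \near 0^'+, (quot mu s < (r / mu r)%:E)%E.
  by apply: limf_einf_gt; rewrite -quot0.
move=> [d /= d0 near0].
have small r : 0 < r -> r < d -> (quot mu s < quot mu r)%E.
  move=> r0 rd; rewrite [ltRHS]quot_pos //; apply: near0 => //=.
  by rewrite sub0r normrN gtr0_norm.
(* [s] cannot beat itself, so it lies in [[d, sbar]]; the minimum over that interval is therefore at
   most [quot mu s], which already beats 0 and every point below [d]. *)
have ds : d <= s by rewrite leNgt; apply/negP => /(small _ s0); rewrite ltxx.
have cont : {within `[d, sbar], continuous (fun r => r / mu r)}.
  apply: continuous_in_subspaceT => r; rewrite inE /= in_itv /= => /andP[dr _].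
  have r0 : 0 < r := lt_le_trans d0 dr.
  have [_ /continuous_within_itvcyP[muC _] _ _] := Kmu.
  apply: cvgM; first exact: cvg_id.
  apply: cvgV; first by rewrite gt_eqF // classK_gt0.
  by apply: muC; rewrite in_itv /= r0.
have [c] := EVT_min (le_trans ds ssbar) cont.
rewrite in_itv /= => /andP[dc csbar] cmin.
have c0 := lt_le_trans d0 dc.
have cs : (quot mu c <= quot mu s)%E.
  by rewrite !quot_pos // lee_fin; apply: cmin; rewrite in_itv /= ds.
exists c; split=> [|r /andP[+ rsbar]]; first by rewrite ltW.
rewrite le_eqVlt => /predU1P[<- | r0]; first exact: le_trans cs (ltW sq).
have [rd | dr] := ltP r d; first exact: le_trans cs (ltW (small r r0 rd)).
by rewrite !quot_pos // lee_fin; apply: cmin; rewrite in_itv /= dr.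
Qed.

Lemma quot_ge_of_linear_bound (R : realType) (mu : R -> R) (K d sbar s : R) :
  classK mu -> 0 < K -> 0 < d ->
  (forall r, 0 <= r -> r < d \/ r <= sbar -> mu r <= K * r) ->
  0 <= s <= sbar -> (K^-1%:E <= quot mu s)%E.
Proof.
move=> Kmu K0 d0 muK /andP[+ ssbar].
have bound r : 0 < r -> r < d \/ r <= sbar -> (K^-1%:E <= (r / mu r)%:E)%E.
  move=> r0 rP; rewrite lee_fin ler_pdivlMr ?classK_gt0 // ler_pdivrMl //.
  by apply: muK => //; exact: ltW.
rewrite le_eqVlt => /predU1P[<- | s0]; last first.
  by rewrite quot_pos //; apply: bound; last right.
rewrite quot0; apply: limf_einf_ge; near=> r.
by apply: bound; [near: r; exact: nbhs_right_gt | left; near: r; exact: nbhs_right_lt].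
Unshelve. all: by end_near. Qed.

(** The linear bound makes [quot mu sstar] at least [K^-1 > 0], so [phi], which tends to 0,
    eventually falls below [eta / K]. *)
Lemma argmin_quot_horizon_exists (R : realType) (mu phi : R -> R)
    (eta sbar sstar : R) :
  0 < eta -> classK mu -> classL phi -> lipschitz_at_origin mu ->
  is_argmin_quot mu sbar sstar ->
  exists Ts : nat, ((phi Ts%:R)%:E <= eta%:E * quot mu sstar)%E.
Proof.
move=> eta0 Kmu Lphi lip [ssbar _].
have [K [d [K0 d0 muK]]] := lipschitz_at_origin_linear_bound sbar Kmu lip.
have [Ts phiTs] := classL_eventually_le Lphi (divr_gt0 eta0 K0).
exists Ts; apply: (@le_trans _ _ (eta%:E * K^-1%:E)%E).
  by rewrite -EFinM lee_fin.
apply: lee_wpmul2l; first by rewrite lee_fin ltW.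
exact: quot_ge_of_linear_bound muK ssbar.
Qed.

(** Minimality turns the bound at [sstar] into [phi Ts <= eta * s / mu s] for every positive [s] in
    range; at [s = 0] both sides of the contraction inequality vanish. *)
Lemma argmin_quot_contractive (R : realType) (mu phi : R -> R)
    (eta sbar sstar : R) (Ts : nat) :
  0 < eta -> classK mu -> is_argmin_quot mu sbar sstar ->
  ((phi Ts%:R)%:E <= eta%:E * quot mu sstar)%E ->
  contractive_horizon mu phi eta sbar Ts.
Proof.
move=> eta0 Kmu [_ smin] phiTs s ssbar.
have := ssbar; rewrite le_eqVlt => /andP[/predU1P[<- _ | s0 _]].
  by have [_ _ -> _] := Kmu; rewrite mul0r mulr0.
have mus0 := classK_gt0 Kmu s0.
have : ((phi Ts%:R)%:E <= eta%:E * quot mu s)%E.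
  by apply: le_trans phiTs _; apply: lee_wpmul2l (smin s ssbar); rewrite lee_fin ltW.
rewrite quot_pos // -EFinM lee_fin mulrA ler_pdivlMr //.
by rewrite mulrC.
Qed.

Lemma contractive_horizon_mono (R : realType) (mu phi : R -> R) (eta sbar : R)
    (Ts T : nat) :
  classK mu -> classL phi -> contractive_horizon mu phi eta sbar Ts ->
  (Ts <= T)%N -> contractive_horizon mu phi eta sbar T.
Proof.
move=> [mu0 _ _ _] [_ _ decr _] contr TsT s ssbar.
apply: le_trans (contr s ssbar); apply: ler_wpM2l.
  by apply: mu0; case/andP: ssbar.
by apply: decr; rewrite ?ler_nat.
Qed.

Lemma lipschitz_horizon (R : realType) (mu phi : R -> R) (eta sbar : R) :
  0 < eta -> 0 <= sbar -> classK mu -> classL phi -> lipschitz_at_origin mu ->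
  (exists Ts : nat, contractive_horizon mu phi eta sbar Ts) /\
  (exists sstar : R, is_argmin_quot mu sbar sstar) /\
  (forall sstar : R, is_argmin_quot mu sbar sstar ->
     (exists Ts : nat, ((phi Ts%:R)%:E <= eta%:E * quot mu sstar)%E) /\
     (forall Ts : nat, ((phi Ts%:R)%:E <= eta%:E * quot mu sstar)%E ->
        contractive_horizon mu phi eta sbar Ts)).
Proof.
move=> eta0 sbar0 Kmu Lphi lip; split; first exact: contractive_horizon_exists.
split=> [|sstar argmin]; first exact: is_argmin_quot_exists.
split=> [|Ts]; first exact: argmin_quot_horizon_exists argmin.
exact: argmin_quot_contractive.
Qed.

(** * Robust stability and convergence *)

Theorem lemma6 (R : realType) (n g p : nat) (P : estimation_problem R n g p)
    (hdyn : continuous (dyn P)) (hobs : continuous (obs P))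
    (M0 Mw Mv eta : R)
    (hM0 : 0 <= M0) (hMw : 0 <= Mw) (hMv : 0 <= Mv) (heta : 0 < eta < 1) :
  (* a) *)
  (forall (betax : R -> R -> R) (alphaw alphav mu phi : R -> R),
     classKL betax -> classK alphaw -> classK alphav ->
     classK mu -> classL phi ->
     (forall (s : R) (t : nat), 0 <= s -> betax s t%:R <= mu s * phi t%:R) ->
     RGAS_by (fie_episodes P) betax alphaw alphav ->
     let sbar := betax M0 0 + (1 - eta)^-1 * (alphaw Mw + alphav Mv) in
     (forall Ts : nat, contractive_horizon mu phi eta sbar Ts ->
        forall T : nat, (0 < T)%N -> (Ts <= T)%N ->
          RGAS (mhe_episodes P T `&` bounded_episodes M0 Mw Mv)) /\
     (lipschitz_at_origin mu ->
        (exists Ts : nat, contractive_horizon mu phi eta sbar Ts) /\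
        (exists sstar : R, is_argmin_quot mu sbar sstar) /\
        (forall sstar : R, is_argmin_quot mu sbar sstar ->
           (exists Ts : nat, ((phi Ts%:R)%:E <= eta%:E * quot mu sstar)%E) /\
           (forall Ts : nat, ((phi Ts%:R)%:E <= eta%:E * quot mu sstar)%E ->
              contractive_horizon mu phi eta sbar Ts)))) /\
  (* b) *)
  (forall (rho : R -> R -> R) (mu phi : R -> R),
     classKL rho -> classK mu -> classL phi ->
     converges_by (fie_episodes P) rho mu phi ->
     let sbar := rho M0 0 in
     (forall Ts : nat, contractive_horizon mu phi eta sbar Ts ->
        forall T : nat, (0 < T)%N -> (Ts <= T)%N ->
          converges (mhe_episodes P T `&` bounded_episodes M0 Mw Mv)) /\
     (lipschitz_at_origin mu ->
        (exists Ts : nat, contractive_horizon mu phi eta sbar Ts) /\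
        (exists sstar : R, is_argmin_quot mu sbar sstar) /\
        (forall sstar : R, is_argmin_quot mu sbar sstar ->
           (exists Ts : nat, ((phi Ts%:R)%:E <= eta%:E * quot mu sstar)%E) /\
           (forall Ts : nat, ((phi Ts%:R)%:E <= eta%:E * quot mu sstar)%E ->
              contractive_horizon mu phi eta sbar Ts)))).
Proof.
have [eta0 eta1] := andP heta.
have inv0 : 0 < (1 - eta)^-1 by rewrite invr_gt0 subr_gt0.
split=> [betax alphaw alphav mu phi KLb Kw Kv Kmu Lphi dom fie sbar
        | rho mu phi KLr Kmu Lphi conv sbar]; split.
- move=> Ts contr T T0 TsT.
  have {contr TsT}contr := contractive_horizon_mono Kmu Lphi contr TsT.
  have KLb0 := proj1 KLb 0 (lexx 0).
  exists (fun s t => betax s 0 * decay eta T t), (fun s => (1 - eta)^-1 * alphaw s),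
    (fun s => (1 - eta)^-1 * alphav s).
  split; [exact: classKL_decay | exact: classK_scale | exact: classK_scale |].
  apply: (mhe_error_bound hM0 hMw hMv heta T0 KLb) => //;
    [exact: classK_nondecreasing | exact: classK_nondecreasing |].
  (* Over exactly one horizon, [betax s T <= mu s * phi T <= eta * s] for a prior error [s] below
     the threshold. *)
  move=> e Ee lenT small; apply: le_trans (fie e Ee) _; rewrite !lerD2r lenT.
  apply: le_trans (dom _ _ (enorm_ge0 _)) _; apply: contr.
  by rewrite enorm_ge0.
- apply: lipschitz_horizon => //.
  have [betax0 _] := classK_nondecreasing (proj1 KLb 0 (lexx 0)).
  have [alphaw0 _] := classK_nondecreasing Kw.
  have [alphav0 _] := classK_nondecreasing Kv.
  by rewrite addr_ge0 ?betax0 // mulr_ge0 ?addr_ge0 ?alphaw0 ?alphav0 // ltW.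
- move=> Ts contr T T0 TsT.
  have {contr TsT}contr := contractive_horizon_mono Kmu Lphi contr TsT.
  have KLr0 := proj1 KLr 0 (lexx 0).
  have gain0 : nondecreasing_gain (fun _ : R => 0) by split.
  (* The bound is itself a product of a class K and a class L function, so the second inequality of
     [converges_by] is an equality. *)
  exists (fun s t => rho s 0 * decay eta T t), (rho ^~ 0), (decay eta T).
  split=> //; [exact: classKL_decay | exact: decay_classL |].
  move=> e Ee; rewrite lexx andbT.
  (* With zero gains the threshold reduces to [rho M0 0]. *)
  have := @mhe_error_bound _ _ _ _ P _ _ _ _ _ _ _ _
    hM0 hMw hMv heta T0 KLr gain0 gain0.
  rewrite /RGAS_by /= !(mulr0, addr0) => H.
  have {H} := H _ _ e Ee; rewrite !addr0; apply.
    by move=> f Ef; rewrite !addr0; case/andP: (conv f Ef).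
  move=> f Ef lenT small; rewrite !addr0.
  have /andP[estr rmu] := conv f Ef; apply: le_trans estr (le_trans rmu _).
  by rewrite lenT; apply: contr; rewrite enorm_ge0.
- apply: lipschitz_horizon => //.
  have [rho0 _] := classK_nondecreasing (proj1 KLr 0 (lexx 0)); exact: rho0.
Qed.
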